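(* Let $E$ be a finite acyclic (directed) graph, let $G(E)$ be the graph inverse semigroup of $E$, and let $L(G(E))$ be the lattice of congruences of $G(E)$. Then the following are equivalent: (i) $L(G(E))$ is lower-semimodular; (ii) $L(G(E))$ is modular; (iii) $L(G(E))$ is distributive. If $E$ is simple, then these conditions are also equivalent to the following: (iv) $\mathbf{r}(e)\ge\mathbf{r}(f)$ or $\mathbf{r}(f)\ge\mathbf{r}(e)$ for all $e,f\in E^1$ such that $\mathbf{s}(e)=\mathbf{s}(f)$.
   Context: A (directed) graph $E=(E^0,E^1,\mathbf{s},\mathbf{r})$ consists of a set $E^0$ of vertices, a set $E^1$ of edges, and functions $\mathbf{s},\mathbf{r}:E^1\to E^0$ (source and range). It is finite if $E^0$ and $E^1$ are finite. A path is a finite sequence $p=e_1\cdots e_n$ of edges with $\mathbf{r}(e_i)=\mathbf{s}(e_{i+1})$ for $1\le i\le n-1$; $\mathbf{s}(p)=\mathbf{s}(e_1)$, $\mathbf{r}(p)=\mathbf{r}(e_n)$; vertices are paths of length $0$. A cycle is a path $e_1\cdots e_n$ with $n\ge1$, equal source and range, and $\mathbf{s}(e_i)\ne\mathbf{s}(e_j)$ for $i\ne j$. A graph is acyclic if it has no cycles. Two distinct edges with the same source and the same range are parallel; a graph is simple if it is acyclic and has no parallel edges. For $u,v\in E^0$ write $u\ge v$ if there is a path (possibly of length $0$) from $u$ to $v$. The graph inverse semigroup $G(E)$ is the semigroup with zero generated by $E^0\cup E^1\cup\{e^{-1}\mid e\in E^1\}$ subject to, for all $u,v\in E^0$ and $e,f\in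 E^1$: $vu=\delta_{v,u}v$; $\mathbf{s}(e)e=e\mathbf{r}(e)=e$; $\mathbf{r}(e)e^{-1}=e^{-1}\mathbf{s}(e)=e^{-1}$; $e^{-1}f=\delta_{e,f}\mathbf{r}(e)$ (here $\delta$ is the Kronecker delta, so $\delta_{x,y}z$ means $z$ if $x=y$ and the zero element otherwise). A congruence on a semigroup $S$ is an equivalence relation $\rho$ on $S$ such that $(x,y)\in\rho$ implies $(zx,zy),(xz,yz)\in\rho$ for all $z\in S$. $L(S)$ is the lattice of all congruences on $S$ ordered by containment. In a lattice, $a\prec b$ means $a<b$ and there is no $c$ with $a<c<b$. A lattice $L$ is lower-semimodular if for all $a,b\in L$, $a\prec a\vee b$ and $b\prec a\vee b$ together imply $a\wedge b\prec a$ and $a\wedge b\prec b$; it is modular if $a\le c$ implies $(a\vee b)\wedge c=a\vee(b\wedge c)$; it is distributive if $a\wedge(b\vee c)=(a\wedge b)\vee(a\wedge c)$ and $a\vee(b\wedge c)=(a\vee b)\wedge(a\vee c)$ for all $a,b,c\in L$. *)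

(* Defs.v *)
From HB Require Import structures.
From mathcomp Require Import all_boot all_order.
From mathcomp Require Import boolp.

Set Implicit Arguments.
Unset Strict Implicit.
Unset Printing Implicit Defensive.

Local Open Scope group_scope.
Local Open Scope quotient_scope.

Section LatticeProperties.
Local Open Scope order_scope.
Context {d : Order.disp_t} (L : latticeType d).

Definition covered_by (a b : L) : Prop := a < b /\ ~ exists c : L, a < c < b.

Definition lower_semimodular : Prop :=
  forall a b : L, covered_by a (a `|` b) -> covered_by b (a `|` b) ->
  covered_by (a `&` b) a /\ covered_by (a `&` b) b.

Definition modular : Prop :=
  forall a b c : L, a <= c -> (a `|` b) `&` c = a `|` (b `&` c).

Definition distributive : Prop :=
  forall a b c : L,
    a `&` (b `|` c) = (a `&` b) `|` (a `&` c) /\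
    a `|` (b `&` c) = (a `|` b) `&` (a `|` c).

End LatticeProperties.

(* Every relation on [S] is reflected by a boolean one ([boolp.asboolP]), so
   taking [cong_rel] boolean-valued loses no congruence. *)
Record congruence (S : semigroupType) := Congruence {
  cong_rel :> rel S;
  cong_refl : reflexive cong_rel;
  cong_sym : symmetric cong_rel;
  cong_trans : transitive cong_rel;
  cong_mull : forall z x y, cong_rel x y -> cong_rel (z * x) (z * y);
  cong_mulr : forall z x y, cong_rel x y -> cong_rel (x * z) (y * z) }.

HB.instance Definition _ (S : semigroupType) := gen_eqMixin (congruence S).
HB.instance Definition _ (S : semigroupType) := gen_choiceMixin (congruence S).

(* The order is containment; join and meet below are its least upper and
   greatest lower bounds ([cong_joinP], [cong_meetP]). *)
Fact congruence_display : Order.disp_t.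
Proof. exact: Order.Disp tt tt. Qed.

Section CongruenceLattice.
Variable S : semigroupType.
Implicit Types c : congruence S.

Definition cong_le c1 c2 : bool := `[< forall x y : S, c1 x y -> c2 x y >].

Lemma cong_leP c1 c2 : reflect (forall x y : S, c1 x y -> c2 x y) (cong_le c1 c2).
Proof. exact: asboolP. Qed.

Lemma congP c1 c2 : (forall x y : S, c1 x y = c2 x y) -> c1 = c2.
Proof.
case: c1 c2 => [r1 a1 b1 t1 l1 m1] [r2 a2 b2 t2 l2 m2] /= r12.
have er : r1 = r2 by apply/funext => x; apply/funext => y.
by subst r2; congr Congruence; exact: Prop_irrelevance.
Qed.

Fact cong_le_refl : reflexive cong_le.
Proof. by move=> c; apply/cong_leP. Qed.

Fact cong_le_anti : antisymmetric cong_le.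
Proof.
move=> c1 c2 /andP[/cong_leP h12 /cong_leP h21].
by apply: congP => x y; apply/idP/idP; [exact: h12 | exact: h21].
Qed.

Fact cong_le_trans : transitive cong_le.
Proof.
move=> c2 c1 c3 /cong_leP h12 /cong_leP h23.
by apply/cong_leP => x y /h12/h23.
Qed.

HB.instance Definition _ := Order.Le_isPOrder.Build
  congruence_display (congruence S) cong_le_refl cong_le_anti cong_le_trans.

Section Generated.
Variable R : S -> S -> Prop.

Definition cong_gen_rel : rel S := fun x y =>
  `[< forall c, (forall a b : S, R a b -> c a b) -> c x y >].

Fact cong_gen_refl : reflexive cong_gen_rel.
Proof. by move=> x; apply/asboolP => c _; exact: cong_refl. Qed.

Fact cong_gen_sym : symmetric cong_gen_rel.
Proof.
move=> x y; apply/asboolP/asboolP => h c Rc; rewrite cong_sym; exact: h.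
Qed.

Fact cong_gen_trans : transitive cong_gen_rel.
Proof.
move=> y x z /asboolP hxy /asboolP hyz; apply/asboolP => c Rc.
exact: cong_trans (hxy c Rc) (hyz c Rc).
Qed.

Fact cong_gen_mull z x y :
  cong_gen_rel x y -> cong_gen_rel (z * x) (z * y).
Proof.
by move=> /asboolP h; apply/asboolP => c Rc; apply: cong_mull; exact: h.
Qed.

Fact cong_gen_mulr z x y :
  cong_gen_rel x y -> cong_gen_rel (x * z) (y * z).
Proof.
by move=> /asboolP h; apply/asboolP => c Rc; apply: cong_mulr; exact: h.
Qed.

Definition cong_gen : congruence S :=
  Congruence cong_gen_refl cong_gen_sym cong_gen_trans cong_gen_mull
    cong_gen_mulr.

Lemma cong_gen_sub x y : R x y -> cong_gen x y.
Proof. by move=> Rxy; apply/asboolP => c; exact. Qed.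

Lemma cong_gen_min c :
  (forall x y : S, R x y -> c x y) -> forall x y, cong_gen x y -> c x y.
Proof. by move=> Rc x y /asboolP; exact. Qed.

End Generated.

Definition cong_join c1 c2 : congruence S :=
  cong_gen (fun x y => c1 x y \/ c2 x y).

Section Meet.
Variables c1 c2 : congruence S.

Definition cong_meet_rel : rel S := fun x y => c1 x y && c2 x y.

Fact cong_meet_refl : reflexive cong_meet_rel.
Proof. by move=> x; rewrite /cong_meet_rel !cong_refl. Qed.

Fact cong_meet_sym : symmetric cong_meet_rel.
Proof. by move=> x y; congr andb; exact: cong_sym. Qed.

Fact cong_meet_trans : transitive cong_meet_rel.
Proof.
move=> y x z /andP[h1 h2] /andP[k1 k2]; apply/andP; split.
  exact: cong_trans h1 k1.
exact: cong_trans h2 k2.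
Qed.

Fact cong_meet_mull z x y :
  cong_meet_rel x y -> cong_meet_rel (z * x) (z * y).
Proof. by case/andP=> h1 h2; apply/andP; split; exact: cong_mull. Qed.

Fact cong_meet_mulr z x y :
  cong_meet_rel x y -> cong_meet_rel (x * z) (y * z).
Proof. by case/andP=> h1 h2; apply/andP; split; exact: cong_mulr. Qed.

Definition cong_meet : congruence S :=
  Congruence cong_meet_refl cong_meet_sym cong_meet_trans cong_meet_mull
    cong_meet_mulr.

End Meet.

Fact cong_meetP c1 c2 c3 :
  (c1 <= cong_meet c2 c3)%O = (c1 <= c2)%O && (c1 <= c3)%O.
Proof.
apply/cong_leP/andP=> [h|[/cong_leP h2 /cong_leP h3] x y hxy].
  by split; apply/cong_leP => x y /h/andP[].
by apply/andP; split; [exact: h2 | exact: h3].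
Qed.

Fact cong_joinP c1 c2 c3 :
  (cong_join c1 c2 <= c3)%O = (c1 <= c3)%O && (c2 <= c3)%O.
Proof.
apply/cong_leP/andP=> [h|[/cong_leP h1 /cong_leP h2]].
  by split; apply/cong_leP => x y hxy; apply/h/cong_gen_sub; [left|right].
by apply: cong_gen_min => x y [/h1|/h2].
Qed.

HB.instance Definition _ := Order.POrder_MeetJoin_isLattice.Build
  congruence_display (congruence S) cong_meetP cong_joinP.

End CongruenceLattice.

Section Quotient.
Variables (S : semigroupType) (c : congruence S).

Definition cong_equiv : equiv_rel S :=
  EquivRel c (@cong_refl _ c) (@cong_sym _ c) (@cong_trans _ c).

Definition quot_semigroup : Type := {eq_quot cong_equiv}.
HB.instance Definition _ := Choice.on quot_semigroup.
HB.instance Definition _ := EqQuotient.on quot_semigroup.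

Definition quot_pi (x : S) : quot_semigroup := \pi x.

Lemma quot_piP (x y : S) : reflect (quot_pi x = quot_pi y) (c x y).
Proof. exact: (@eqquotP _ cong_equiv quot_semigroup). Qed.

Lemma quot_reprK (a : quot_semigroup) : quot_pi (repr a) = a.
Proof. exact: reprK. Qed.

Definition quot_mul (a b : quot_semigroup) : quot_semigroup :=
  quot_pi (repr a * repr b).

Lemma quot_piM (x y : S) : quot_pi (x * y) = quot_mul (quot_pi x) (quot_pi y).
Proof.
have reprP (z : S) : c z (repr (quot_pi z)).
  by apply/quot_piP; rewrite quot_reprK.
apply/quot_piP.
exact: cong_trans (cong_mulr y (reprP x)) (cong_mull _ (reprP y)).
Qed.

Fact quot_mulA : associative quot_mul.
Proof.
move=> a b d; rewrite -(quot_reprK a) -(quot_reprK b) -(quot_reprK d).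
by move: (repr a) (repr b) (repr d) => x y z; rewrite -!quot_piM mulgA.
Qed.

HB.instance Definition _ := isSemigroup.Build quot_semigroup quot_mulA.

End Quotient.

(* The free semigroup with zero on [X]: [None] is the zero element, and
   [Some (x, s)] is the nonempty word [x :: s]. *)
Definition free_semigroup0 (X : choiceType) : Type := option (X * seq X).
HB.instance Definition _ (X : choiceType) := Choice.on (free_semigroup0 X).

Section Free.
Variable X : choiceType.

Definition free_mul (a b : free_semigroup0 X) : free_semigroup0 X :=
  match a, b with
  | Some (x, s), Some (y, t) => Some (x, s ++ y :: t)
  | _, _ => None
  end.

Fact free_mulA : associative free_mul.
Proof. by move=> [[x s]|] [[y t]|] [[z u]|] //=; rewrite -catA. Qed.

HB.instance Definition _ := isSemigroup.Build (free_semigroup0 X) free_mulA.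

Definition free_zero : free_semigroup0 X := None.
Definition free_gen (x : X) : free_semigroup0 X := Some (x, [::]).

End Free.

(* The quotient of the free semigroup with zero by the least congruence
   containing [R]; its zero is the class of [free_zero X]. *)
Definition presented_semigroup0 (X : choiceType)
    (R : free_semigroup0 X -> free_semigroup0 X -> Prop) : semigroupType :=
  quot_semigroup (cong_gen R).

Record finite_digraph := FiniteDigraph {
  vertex : finType;
  edge : finType;
  source : edge -> vertex;
  range : edge -> vertex }.

Section Digraph.
Variable E : finite_digraph.
Implicit Types (u v : vertex E) (e f : edge E) (p : seq (edge E)).

(* [is_path u p v]: [p] is a path from [u] to [v]; the vertex [u], as a path
   of length 0, is represented by [u], [::], [u]. *)
Fixpoint is_path u p v : bool :=
  if p is e :: q then (source e == u) && is_path (range e) q v else u == v.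

Definition reaches u v : Prop := exists p, is_path u p v.

Definition is_cycle p : Prop :=
  [/\ p != [::], (exists v, is_path v p v) & uniq (map (@source E) p)].

Definition acyclic : Prop := ~ exists p, is_cycle p.

Definition parallel e f : Prop :=
  [/\ e <> f, source e = source f & range e = range f].

Definition simple_graph : Prop := acyclic /\ ~ exists e f, parallel e f.

End Digraph.

Inductive gis_gen (E : finite_digraph) : Type :=
  | GVertex of vertex E
  | GEdge of edge E
  | GInv of edge E.

Section GisGenChoice.
Variable E : finite_digraph.

Definition gis_gen_code (x : gis_gen E) : vertex E + (edge E + edge E) :=
  match x with
  | GVertex v => inl v
  | GEdge e => inr (inl e)
  | GInv e => inr (inr e)
  end.

Definition gis_gen_decode (x : vertex E + (edge E + edge E)) : gis_gen E :=
  match x with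
  | inl v => GVertex v
  | inr (inl e) => GEdge e
  | inr (inr e) => GInv e
  end.

Fact gis_gen_codeK : cancel gis_gen_code gis_gen_decode.
Proof. by case. Qed.

HB.instance Definition _ := Choice.copy (gis_gen E) (can_type gis_gen_codeK).

End GisGenChoice.

Section GraphInverseSemigroup.
Variable E : finite_digraph.

Local Notation F := (free_semigroup0 (gis_gen E)).
Local Notation vtx v := (free_gen (GVertex v) : F).
Local Notation edg e := (free_gen (GEdge e) : F).
Local Notation inve e := (free_gen (GInv e) : F).
Local Notation zero := (free_zero (gis_gen E)).

(* The conditional right-hand sides are the Kronecker deltas of the defining
   relations. *)
Inductive gis_relation : F -> F -> Prop :=
  | gis_vv v u : gis_relation (vtx v * vtx u) (if v == u then vtx v else zero)
  | gis_se e : gis_relation (vtx (source e) * edg e) (edg e)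
  | gis_er e : gis_relation (edg e * vtx (range e)) (edg e)
  | gis_ri e : gis_relation (vtx (range e) * inve e) (inve e)
  | gis_is e : gis_relation (inve e * vtx (source e)) (inve e)
  | gis_ie e f :
      gis_relation (inve e * edg f) (if e == f then vtx (range e) else zero).

Definition graph_inverse_semigroup : semigroupType :=
  presented_semigroup0 gis_relation.

End GraphInverseSemigroup.

(* Main.v *)
Require Import Defs.
From mathcomp Require Import all_boot all_order.
From mathcomp Require Import boolp.

Set Implicit Arguments.
Unset Strict Implicit.
Unset Printing Implicit Defensive.

Local Open Scope group_scope.

(** A congruence of [G(E)] is determined by the set [K] of the vertices [v] that
    it identifies with zero or with an idempotent [e e^-1], for an edge [e] out of
    [v] ([collapsed], [collapsed_le]). Acyclicity makes this one set suffice: the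
    vertices identified with zero are those all of whose descendants are in [K].

    If [v ~ e e^-1], then multiplying by any other edge [f] out of [v] gives
    [range f ~ 0]. Hence [K] is [admissible]: for each vertex of [K], all out-edges
    but at most one have all the descendants of their ranges in [K]. Conversely
    [G(E)] acts on the paths ending outside [K] by adding and deleting first edges,
    and the kernel of this action gives back [K] ([collapsed_cong_of]). So the
    congruence lattice is isomorphic to the family of admissible sets ordered by
    inclusion.

    This family is closed under union. It is closed under intersection, hence a
    distributive lattice, unless the graph has a [fork]: distinct edges [e] and [f]
    out of a vertex [v] such that [range e] is reachable from the range of no other
    edge out of [v], and likewise for [range f] ([no_fork_distributive]). At a fork,
    removing [range e] or [range f] from the descendants of [v] leaves two
    admissible sets that are covered by their union, but an admissible set that
    avoids both ranges also avoids [v], so lower semimodularity fails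
    ([lower_semimodular_no_fork]). The other implications between the three lattice
    properties hold in every lattice. In a simple graph, having no fork amounts to
    the descendants of each vertex being totally ordered by reachability
    ([no_fork_chain]), which is the comparability condition on edges. *)

(** * Lattices *)

Section Lattices.
Local Open Scope order_scope.
Context {d : Order.disp_t} (L : latticeType d).
Import Order.LTheory.

Lemma distributive_modular : distributive L -> modular L.
Proof. by move=> dL a b c /join_r ac; rewrite (dL a b c).2 ac. Qed.

(** In a modular lattice, joining with [a] embeds the interval from [a `&` b]
    to [b] into the one from [a] to [a `|` b]. *)
Lemma modular_covered_meet (a b : L) :
  modular L -> covered_by a (a `|` b) -> covered_by (a `&` b) b.
Proof.
move=> mL [ab nab]; split.
  rewrite lt_neqAle leIr andbT; apply/eqP => /meet_idPr/join_l abE.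
  by rewrite abE ltxx in ab.
case=> c /andP[abc cb]; apply: nab; exists (a `|` c).
rewrite !lt_neqAle leUl leU2 ?(ltW cb) //= !andbT; apply/andP; split.
  apply/eqP => ac; have ca : c <= a by rewrite ac leUr.
  have : c <= a `&` b by rewrite lexI ca ltW.
  by rewrite (lt_geF abc).
apply/eqP => acb; have := mL c a b (ltW cb).
rewrite joinC acb joinIK => bE.
by move: cb; rewrite {1}bE (join_l (ltW abc)) ltxx.
Qed.

Lemma modular_lower_semimodular : modular L -> lower_semimodular L.
Proof.
move=> mL a b ha hb; split; last exact: modular_covered_meet ha.
by rewrite meetC; apply: modular_covered_meet; rewrite // joinC.
Qed.

End Lattices.

(** * Paths in an acyclic graph *)

Section Paths.
Variable E : finite_digraph.
Implicit Types (u v w : vertex E) (e f g : edge E) (p q : seq (edge E)).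

Lemma is_path_cat u p q w :
  is_path u (p ++ q) w <-> exists2 v, is_path u p v & is_path v q w.
Proof.
elim: p u => [|e p IH] u /=.
  by split=> [upq|[v /eqP->]//]; exists u.
split=> [/andP[-> /IH[v ? ?]]|[v /andP[-> pv] qw]]; first by exists v.
by apply/IH; exists v.
Qed.

Lemma reaches_refl v : reaches v v.
Proof. by exists [::] => /=. Qed.

Lemma reaches_trans u v w : reaches u v -> reaches v w -> reaches u w.
Proof.
by move=> [p up] [q vq]; exists (p ++ q); apply/is_path_cat; exists v.
Qed.

Lemma edge_reaches e : reaches (source e) (range e).
Proof. by exists [:: e]; rewrite /= !eqxx. Qed.

Lemma reachesE u v :
  reaches u v -> u = v \/ exists2 e, source e = u & reaches (range e) v.
Proof.
case=> [[|e p]] /= => [/eqP|/andP[/eqP eu ep]]; first by left.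
by right; exists e => //; exists p.
Qed.

(** The part of a path between two visits to the same vertex is closed. *)
Lemma closed_subpath u p w :
    is_path u p w -> ~~ uniq (map (@source E) p) ->
  exists v q, [/\ q != [::], is_path v q v & size q < size p].
Proof.
elim: p u => // e p IH u /= /andP[/eqP eu ep] /nandP[/negPn/mapP[f]|nup].
  move=> fp ef; case/splitPr: fp ep => p1 p2 ep.
  have [x e1 /=/andP[/eqP fx _]] := (is_path_cat _ _ _ _).1 ep.
  exists (source e), (e :: p1); rewrite /= eqxx ef fx e1.
  by rewrite size_cat /= addnS !ltnS leq_addr.
have [v [q [q0 vq lqp]]] := IH _ ep nup.
by exists v, q; split => //; exact: ltnW.
Qed.

Lemma closed_path_cycle v p :
  p != [::] -> is_path v p v -> exists q, @is_cycle E q.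
Proof.
have [n] := ubnP (size p); elim: n v p => // n IH v p szp p0 pv.
have [up|nup] := boolP (uniq (map (@source E) p)).
  by exists p; split => //; exists v.
have [w [q [q0 wq lqp]]] := closed_subpath pv nup.
by apply: IH q0 wq; exact: leq_trans lqp szp.
Qed.

Hypothesis acyclicE : acyclic E.

Lemma closed_path_nil v p : is_path v p v -> p = [::].
Proof.
move=> pv; have [//|p0] := eqVneq p [::].
by case: acyclicE; exact: closed_path_cycle pv.
Qed.

Lemma reaches_anti u v : reaches u v -> reaches v u -> u = v.
Proof.
move=> [p up] [q vq].
have /closed_path_nil : is_path u (p ++ q) u by apply/is_path_cat; exists v.
by case: p up => [/= /eqP|].
Qed.

Lemma range_not_reaches_source e : ~ reaches (range e) (source e).
Proof.
move=> [p ep]; have /closed_path_nil// : is_path (source e) (e :: p) (source e).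
by rewrite /= eqxx.
Qed.

Definition descendants v : {set vertex E} := [set w | `[< reaches v w >]].

Lemma descendantsP v w : reflect (reaches v w) (w \in descendants v).
Proof. by rewrite inE; apply: asboolP. Qed.

Lemma descendants_refl v : v \in descendants v.
Proof. by apply/descendantsP; exact: reaches_refl. Qed.

Lemma descendants_sub u v : reaches u v -> descendants v \subset descendants u.
Proof.
move=> uv; apply/subsetP => w /descendantsP vw.
exact/descendantsP/(reaches_trans uv).
Qed.

Lemma descendants_inj u v : descendants u = descendants v -> u = v.
Proof.
move=> uv; apply: reaches_anti; apply/descendantsP.
  by rewrite uv descendants_refl.
by rewrite -uv descendants_refl.
Qed.

(** Along an edge the set of descendants shrinks strictly, so a property can be
    proved at a vertex assuming it at the ranges of its out-edges. *)
Lemma edge_ind (P : vertex E -> Prop) :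
  (forall v, (forall e, source e = v -> P (range e)) -> P v) -> forall v, P v.
Proof.
move=> IP v; have [n] := ubnP #|descendants v|; elim: n v => // n IH v vn.
apply: IP => e ev; apply: IH; rewrite -ltnS (leq_trans _ vn)// ltnS.
apply: proper_card; rewrite -ev properE (descendants_sub (edge_reaches e)) /=.
apply/subsetPn; exists (source e); first exact: descendants_refl.
by apply/descendantsP/range_not_reaches_source.
Qed.

End Paths.

(** * Normal forms in the graph inverse semigroup *)

Section NormalForms.
Variable E : finite_digraph.
Implicit Types (u v w : vertex E) (e f g : edge E) (p q t : seq (edge E)).

Local Notation S := (graph_inverse_semigroup E).
Local Notation F := (free_semigroup0 (gis_gen E)).
Implicit Types (x y z : S) (rho sigma : congruence S).

Definition gis_class (a : F) : S := quot_pi (cong_gen (@gis_relation E)) a.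
Definition gis_zero : S := gis_class (free_zero _).
Definition gis_vertex v : S := gis_class (free_gen (GVertex v)).
Definition gis_edge e : S := gis_class (free_gen (GEdge e)).
Definition gis_inv e : S := gis_class (free_gen (GInv e)).

Lemma gis_classM (a b : F) : gis_class (a * b) = gis_class a * gis_class b.
Proof. exact: quot_piM. Qed.

Lemma gis_class_rel (a b : F) : gis_relation a b -> gis_class a = gis_class b.
Proof. by move=> ab; apply/quot_piP/cong_gen_sub. Qed.

Lemma gis_class_surj x : exists a, x = gis_class a.
Proof. by exists (repr x); rewrite /gis_class quot_reprK. Qed.

Lemma mul0g x : gis_zero * x = gis_zero.
Proof. by have [a ->] := gis_class_surj x; rewrite -gis_classM. Qed.

Lemma mulg0 x : x * gis_zero = gis_zero.
Proof. by have [[[b s]|] ->] := gis_class_surj x; rewrite -gis_classM. Qed.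

Lemma gis_vertexM v u :
  gis_vertex v * gis_vertex u = if v == u then gis_vertex v else gis_zero.
Proof.
by rewrite -gis_classM (gis_class_rel (gis_vv v u)); case: eqP.
Qed.

Lemma gis_vertexK v : gis_vertex v * gis_vertex v = gis_vertex v.
Proof. by rewrite gis_vertexM eqxx. Qed.

Lemma gis_source_edge e : gis_vertex (source e) * gis_edge e = gis_edge e.
Proof. by rewrite -gis_classM (gis_class_rel (gis_se e)). Qed.

Lemma gis_edge_range e : gis_edge e * gis_vertex (range e) = gis_edge e.
Proof. by rewrite -gis_classM (gis_class_rel (gis_er e)). Qed.

Lemma gis_range_inv e : gis_vertex (range e) * gis_inv e = gis_inv e.
Proof. by rewrite -gis_classM (gis_class_rel (gis_ri e)). Qed.

Lemma gis_inv_source e : gis_inv e * gis_vertex (source e) = gis_inv e.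
Proof. by rewrite -gis_classM (gis_class_rel (gis_is e)). Qed.

Lemma gis_inv_edge e f :
  gis_inv e * gis_edge f = if e == f then gis_vertex (range e) else gis_zero.
Proof.
by rewrite -gis_classM (gis_class_rel (gis_ie e f)); case: eqP.
Qed.

Fixpoint path_elt v p : S :=
  if p is e :: q then gis_edge e * path_elt (range e) q else gis_vertex v.

Fixpoint path_inv v p : S :=
  if p is e :: q then path_inv (range e) q * gis_inv e else gis_vertex v.

Lemma vertex_path v p w :
  is_path v p w -> gis_vertex v * path_elt v p = path_elt v p.
Proof.
case: p => [|e p] /= => [_|/andP[/eqP<- _]]; first exact: gis_vertexK.
by rewrite mulgA gis_source_edge.
Qed.

Lemma path_vertex v p w :
  is_path v p w -> path_elt v p * gis_vertex w = path_elt v p.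
Proof.
elim: p v => [|e p IH] v /= => [/eqP->|/andP[_ /IH ep]]; first exact: gis_vertexK.
by rewrite -mulgA ep.
Qed.

Lemma path_inv_vertex v p w :
  is_path v p w -> path_inv v p * gis_vertex v = path_inv v p.
Proof.
case: p => [|e p] /= => [_|/andP[/eqP<- _]]; first exact: gis_vertexK.
by rewrite -mulgA gis_inv_source.
Qed.

Lemma vertex_path_inv v p w :
  is_path v p w -> gis_vertex w * path_inv v p = path_inv v p.
Proof.
elim: p v => [|e p IH] v /= => [/eqP->|/andP[_ /IH ep]]; first exact: gis_vertexK.
by rewrite mulgA ep.
Qed.

Lemma path_invK v p w :
  is_path v p w -> path_inv v p * path_elt v p = gis_vertex w.
Proof.
elim: p v => [|e p IH] v /= => [/eqP->|/andP[_ ep]]; first exact: gis_vertexK.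
rewrite mulgA -(mulgA _ _ (gis_edge e)) gis_inv_edge eqxx.
by rewrite (path_inv_vertex ep) IH.
Qed.

Lemma path_elt_cat v p w q (x : vertex E) :
    is_path v p w -> is_path w q x ->
  path_elt v (p ++ q) = path_elt v p * path_elt w q.
Proof.
move=> + wq; elim: p v => [|e p IH] v /= => [/eqP->|/andP[_ ep]].
  by rewrite (vertex_path wq).
by rewrite (IH _ ep) mulgA.
Qed.

Lemma path_inv_cat v p w q (x : vertex E) :
    is_path v p w -> is_path w q x ->
  path_inv v (p ++ q) = path_inv w q * path_inv v p.
Proof.
move=> + wq; elim: p v => [|e p IH] v /= => [/eqP->|/andP[_ ep]].
  by rewrite (path_inv_vertex wq).
by rewrite (IH _ ep) mulgA.
Qed.

Inductive normal_form : S -> Prop :=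
  | normal_zero : normal_form gis_zero
  | normal_path v p u q w of is_path v p w & is_path u q w :
      normal_form (path_elt v p * path_inv u q).

Lemma vertex_path_neq u v p w :
  is_path v p w -> u != v -> gis_vertex u * path_elt v p = gis_zero.
Proof.
move=> vp uv; rewrite -(vertex_path vp) mulgA gis_vertexM (negPf uv).
exact: mul0g.
Qed.

Lemma path_inv_vertex_neq u v p w :
  is_path v p w -> v != u -> path_inv v p * gis_vertex u = gis_zero.
Proof.
move=> vp uv; rewrite -(path_inv_vertex vp) -mulgA gis_vertexM (negPf uv).
exact: mulg0.
Qed.

Lemma normal_vertexM u x : normal_form x -> normal_form (gis_vertex u * x).
Proof.
case=> [|v p a q w vp aq]; first by rewrite mulg0; exact: normal_zero.
rewrite mulgA; have [->|uv] := eqVneq u v.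
  by rewrite (vertex_path vp); exact: normal_path vp aq.
by rewrite (vertex_path_neq vp uv) mul0g; exact: normal_zero.
Qed.

Lemma normal_edgeM e x : normal_form x -> normal_form (gis_edge e * x).
Proof.
case=> [|v p a q w vp aq]; first by rewrite mulg0; exact: normal_zero.
rewrite mulgA; have [ev|ev] := eqVneq (range e) v.
  subst v; rewrite -[_ * path_elt _ p]/(path_elt (source e) (e :: p)).
  by apply: normal_path aq; rewrite /= eqxx.
rewrite -gis_edge_range -(mulgA _ _ (path_elt v p)).
by rewrite (vertex_path_neq vp ev) mulg0 mul0g; exact: normal_zero.
Qed.

(** The inverse of an edge either cancels the first edge of [p] or, when [p] is a
    vertex, extends [q] by one edge. *)
Lemma normal_invM e x : normal_form x -> normal_form (gis_inv e * x).
Proof.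
case=> [|v [|f p] a q w vp aq]; first by rewrite mulg0; exact: normal_zero.
  have vw : v = w by apply/eqP.
  subst w; rewrite /= mulgA; have [ev|ev] := eqVneq (source e) v.
    have ve : is_path v [:: e] (range e) by rewrite /= ev !eqxx.
    have eE : path_inv v [:: e] = gis_inv e by rewrite /= gis_range_inv.
    rewrite -{1}ev gis_inv_source -eE -(path_inv_cat aq ve).
    rewrite -(vertex_path_inv (w := range e)); last first.
      by apply/is_path_cat; exists v.
    apply: (@normal_path (range e) [::] _ _ (range e)); first by rewrite /=.
    by apply/is_path_cat; exists v.
  rewrite -gis_inv_source -(mulgA _ _ (gis_vertex v)) gis_vertexM (negPf ev).
  by rewrite mulg0 mul0g; exact: normal_zero.
move: vp => /= /andP[_ fp]; rewrite !mulgA gis_inv_edge; case: eqP => [->|_].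
  by rewrite (vertex_path fp); exact: normal_path fp aq.
by rewrite !mul0g; exact: normal_zero.
Qed.

Lemma normal_genM (a : gis_gen E) x :
  normal_form x -> normal_form (gis_class (free_gen a) * x).
Proof.
case: a => c; [exact: normal_vertexM | exact: normal_edgeM | exact: normal_invM].
Qed.

(** Normal forms are stable under left multiplication by generators, so the claim
    follows by induction on a word representing [x]. *)
Lemma gis_normal x : normal_form x.
Proof.
have [[[a s]|] ->] := gis_class_surj x; last exact: normal_zero.
elim: s a => [|b s IH] a; last first.
  by rewrite -[gis_class _]/(gis_class (free_gen a * Some (b, s))) gis_classM;
    exact: normal_genM.
suff [y ny ->] : exists2 y, normal_form y & gis_class (Some (a, [::])) =
    gis_class (free_gen a) * y by exact: normal_genM.
have nv v : normal_form (gis_vertex v).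
  rewrite -gis_vertexK; apply: (@normal_path v [::] v [::] v) => //=.
case: a => c.
- by exists (gis_vertex c); rewrite ?gis_vertexK.
- by exists (gis_vertex (range c)); rewrite ?gis_edge_range.
- by exists (gis_vertex (source c)); rewrite ?gis_inv_source.
Qed.

(** Cancelling letter by letter, [q^-1 p] vanishes at the first edge where [p] and
    [q] differ. *)
Lemma path_inv_path v p w q (x : vertex E) :
    is_path v p w -> is_path v q x ->
  [\/ exists2 t, p = q ++ t & is_path x t w,
      exists2 t, q = p ++ t & is_path w t x
    | path_inv v q * path_elt v p = gis_zero].
Proof.
elim: q v p => [|e q IH] v [|f p] /=.
- by move=> /eqP<- /eqP<-; constructor 1; exists [::] => /=.
- by move=> vp /eqP<-; constructor 1; exists (f :: p).
- by move=> /eqP<- vq; constructor 2; exists (e :: q).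
move=> /andP[/eqP fv fp] /andP[/eqP ev eq].
rewrite mulgA -(mulgA _ (gis_inv e)) gis_inv_edge; case: eqP => [ef|_]; last first.
  by constructor 3; rewrite mulg0 mul0g.
subst f; rewrite (path_inv_vertex eq).
case: (IH _ _ fp eq) => [[t -> xt]|[t -> wt]|->].
- by constructor 1; exists t.
- by constructor 2; exists t.
- by constructor 3.
Qed.

Definition path_idem v p := path_elt v p * path_inv v p.

Lemma path_idem_mul v p w y :
  is_path v p w -> path_idem v p * (path_elt v p * y) = path_elt v p * y.
Proof.
move=> vp; rewrite /path_idem -!mulgA [path_inv _ _ * _]mulgA (path_invK vp).
by rewrite mulgA (path_vertex vp).
Qed.

Lemma mul_path_idem v p w y :
  is_path v p w -> (y * path_inv v p) * path_idem v p = y * path_inv v p.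
Proof.
move=> vp; rewrite /path_idem -!mulgA [path_inv _ _ * (_ * _)]mulgA (path_invK vp).
by rewrite (vertex_path_inv vp).
Qed.

Lemma path_idem_cat v p w t (x : vertex E) :
    is_path v p w -> is_path w t x ->
  path_idem v p * path_idem v (p ++ t) = path_idem v (p ++ t) /\
  path_idem v (p ++ t) * path_idem v p = path_idem v (p ++ t).
Proof.
move=> vp wt.
have lE : path_idem v (p ++ t) =
    path_elt v p * (path_elt w t * path_inv v (p ++ t)).
  by rewrite /path_idem (path_elt_cat vp wt) mulgA.
have rE : path_idem v (p ++ t) =
    path_elt v (p ++ t) * path_inv w t * path_inv v p.
  by rewrite /path_idem (path_inv_cat vp wt) mulgA.
by rewrite {1 2}lE (path_idem_mul _ vp) {1}rE (mul_path_idem _ vp) -rE -lE.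
Qed.

(** One of two paths is a prefix of the other, and then the idempotent of the
    longer one absorbs that of the shorter; otherwise both products vanish. *)
Lemma path_idemC v p w u q (x : vertex E) :
    is_path v p w -> is_path u q x ->
  path_idem v p * path_idem u q = path_idem u q * path_idem v p.
Proof.
have idem0 v1 p1 w1 v2 p2 w2 : is_path v1 p1 w1 -> is_path v2 p2 w2 ->
    v1 != v2 -> path_idem v1 p1 * path_idem v2 p2 = gis_zero.
  move=> vp1 vp2 v12; rewrite /path_idem -(path_inv_vertex vp1) -!mulgA.
  by rewrite [gis_vertex _ * _]mulgA (vertex_path_neq vp2 v12) mul0g !mulg0.
move=> vp uq; have [uv|uv] := eqVneq u v; last first.
  by rewrite (idem0 _ _ _ _ _ _ uq vp uv) (idem0 _ _ _ _ _ _ vp uq) // eq_sym.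
subst u; case: (path_inv_path vp uq) => [[t -> xt]|[t -> wt]|qp0].
- by have [-> ->] := path_idem_cat uq xt.
- by have [-> ->] := path_idem_cat vp wt.
have qp : path_idem v q * path_idem v p = gis_zero.
  by rewrite /path_idem -mulgA (mulgA (path_inv v q)) qp0 mul0g mulg0.
case: (path_inv_path uq vp) => [[t qE wt]|[t pE xt]|pq0].
- by have [] := path_idem_cat vp wt; rewrite -qE qp => -> ->.
- by have [] := path_idem_cat uq xt; rewrite -pE qp => -> ->.
by rewrite qp /path_idem -mulgA (mulgA (path_inv v p)) pq0 mul0g mulg0.
Qed.

End NormalForms.

(** * A congruence is determined by the vertices it collapses *)

Section Determined.
Variable E : finite_digraph.
Hypothesis acyclicE : acyclic E.
Implicit Types (u v w : vertex E) (e f g : edge E) (p q t : seq (edge E)).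

Local Notation S := (graph_inverse_semigroup E).
Implicit Types (x y z : S) (rho sigma : congruence S).

Local Notation "0" := (@gis_zero E).

Section Inclusion.
Variables rho sigma : congruence S.
Hypothesis sub_zero :
  forall v, rho (gis_vertex v) 0 -> sigma (gis_vertex v) 0.
Hypothesis sub_idem :
  forall e, rho (gis_vertex (source e)) (gis_edge e * gis_inv e) ->
            sigma (gis_vertex (source e)) (gis_edge e * gis_inv e).

Lemma path_zero_sub v p u q w : is_path v p w -> is_path u q w ->
  rho (path_elt v p * path_inv u q) 0 -> sigma (path_elt v p * path_inv u q) 0.
Proof.
move=> vp uq /(cong_mulr (path_elt u q)) /(cong_mull (path_inv v p)).
rewrite mul0g mulg0 -!mulgA (path_invK uq) (path_vertex vp) (path_invK vp).
move=> /sub_zero /(cong_mulr (path_inv u q)) /(cong_mull (path_elt v p)).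
by rewrite mul0g mulg0 (vertex_path_inv uq).
Qed.

(** Multiplying [v ~ p p^-1] by [e e^-1], where [e] is the first edge of [p],
    gives [v ~ e e^-1]; conjugating by [e] then removes [e] from [p]. *)
Lemma path_idem_sub v p w : is_path v p w ->
  rho (gis_vertex v) (path_idem v p) -> sigma (gis_vertex v) (path_idem v p).
Proof.
elim: p v => [|e p IH] v /=.
  by move=> _ _; rewrite /path_idem /= gis_vertexK; exact: cong_refl.
move=> /andP[/eqP<- {v}]; set v := source e => ep vp.
have ve : is_path v [:: e] (range e) by rewrite /= !eqxx.
have eE : path_idem v [:: e] = gis_edge e * gis_inv e.
  by rewrite /path_idem /= gis_edge_range gis_range_inv.
have pE : path_idem v (e :: p) = gis_edge e * path_idem (range e) p * gis_inv e.
  by rewrite /path_idem /= !mulgA.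
have ve_rho : rho (gis_vertex v) (gis_edge e * gis_inv e).
  apply: cong_trans (vp) _; rewrite cong_sym -eE.
  have := cong_mulr (path_idem v [:: e]) vp.
  (* the idempotent of [e :: p] absorbs [e e^-1] *)
  rewrite (path_idem_cat ve ep).2 {1}/path_idem mulgA (vertex_path ve).
  by [].
have rp : rho (gis_vertex (range e)) (path_idem (range e) p).
  have := cong_mulr (gis_edge e) (cong_mull (gis_inv e) vp).
  rewrite gis_inv_source pE -!mulgA !gis_inv_edge eqxx.
  rewrite (mulgA (gis_inv e)) gis_inv_edge eqxx.
  by rewrite /path_idem (path_inv_vertex ep) mulgA (vertex_path ep).
apply: cong_trans (sub_idem ve_rho) _; rewrite pE.
rewrite -{1}[gis_edge e]gis_edge_range.
by apply: cong_mulr; apply: cong_mull; exact: IH rp.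
Qed.

(** Write [z = t u^-1] with [t], [u] paths from [v]. Either [t = u], or acyclicity
    makes [t] and [u] incomparable; then [z^2 = 0], and [v ~ z] gives [v ~ 0]. *)
Lemma vertex_sub v z :
    gis_vertex v * z = z -> z * gis_vertex v = z ->
  rho (gis_vertex v) z -> sigma (gis_vertex v) z.
Proof.
case: (gis_normal z) => [|a p b q w ap bq] vz zv vz_rho; first exact: sub_zero.
have z0 : path_elt a p * path_inv b q = 0 ->
    sigma (gis_vertex v) (path_elt a p * path_inv b q).
  by move=> z0; move: vz_rho; rewrite z0; exact: sub_zero.
have [av|av] := eqVneq v a; last first.
  by apply: z0; rewrite -vz mulgA (vertex_path_neq ap av) mul0g.
have [bv|bv] := eqVneq b v; last first.
  by apply: z0; rewrite -zv -mulgA (path_inv_vertex_neq bq bv) mulg0.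
subst a b.
have pq : p = q -> sigma (gis_vertex v) (path_elt v p * path_inv v q).
  by move=> pq; move: vz_rho; rewrite -pq; exact: path_idem_sub ap.
case: (path_inv_path ap bq) => [[t pE wt]|[t pE wt]|qp0].
- by apply: pq; rewrite pE (closed_path_nil acyclicE wt) cats0.
- by apply: pq; rewrite pE (closed_path_nil acyclicE wt) cats0.
have v0 : rho (gis_vertex v) 0.
  apply: cong_trans (vz_rho) _; rewrite -{1}vz.
  apply: cong_trans (cong_mulr _ vz_rho) _.
  rewrite mulgA -(mulgA _ (path_inv v q)) qp0 mulg0 mul0g; exact: cong_refl.
apply: cong_trans (sub_zero v0) _; rewrite cong_sym.
apply: (path_zero_sub ap bq); apply: cong_trans v0.
by rewrite cong_sym.
Qed.

(** [p^-1 y q] is congruent to [p^-1 (p q^-1) q], which is the common range of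
    [p] and [q], so the case of a vertex applies. *)
Lemma compress_sub v p u q w y : is_path v p w -> is_path u q w ->
    rho (path_elt v p * path_inv u q) y ->
  sigma (path_elt v p * path_inv u q) (path_idem v p * y * path_idem u q).
Proof.
move=> vp uq xy; set z := path_inv v p * y * path_elt u q.
have wz : sigma (gis_vertex w) z.
  apply: vertex_sub; first by rewrite /z !mulgA (vertex_path_inv vp).
    by rewrite /z -!mulgA (path_vertex uq).
  have := cong_mulr (path_elt u q) (cong_mull (path_inv v p) xy).
  by rewrite -!mulgA (path_invK uq) (path_vertex vp) (path_invK vp) mulgA.
have := cong_mulr (path_inv u q) (cong_mull (path_elt v p) wz).
by rewrite (path_vertex vp) /z /path_idem !mulgA.
Qed.

(** For [x = p q^-1] and [y = r s^-1], let [i], [j], [k], [l] be the idempotents of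
    [p], [q], [r], [s]. Compression gives [x ~ i y j] and [y ~ k x l]. As
    idempotents commute and [k y l = y], these give [k x ~ x] and [x l ~ x], so
    that [y ~ k x l ~ x]. *)
Lemma congruence_sub x y : rho x y -> sigma x y.
Proof.
case: (gis_normal x) => [|v p u q w vp uq];
  case: (gis_normal y) => [|a r b s c ar bs].
- by move=> _; exact: cong_refl.
- by rewrite cong_sym => /(path_zero_sub ar bs); rewrite cong_sym.
- exact: path_zero_sub vp uq.
set X := _ * path_inv u q; set Y := _ * path_inv b s => XY.
have YX : rho Y X by rewrite cong_sym.
have {XY} sX := compress_sub vp uq XY; have {YX} sY := compress_sub ar bs YX.
rewrite -/X in sX sY; rewrite -/Y in sX sY.
set i := path_idem v p in sX; set j := path_idem u q in sX.
set k := path_idem a r in sY; set l := path_idem b s in sY.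
have kY : k * Y = Y by exact: path_idem_mul ar.
have Yl : Y * l = Y by exact: mul_path_idem bs.
have ki : k * i = i * k by exact: path_idemC ar vp.
have jl : j * l = l * j by exact: path_idemC uq bs.
clearbody i j k l X Y.
have kX : sigma (k * X) X.
  apply: cong_trans (cong_mull k sX) _.
  by rewrite !mulgA ki -(mulgA i) kY cong_sym.
have Xl : sigma (X * l) X.
  apply: cong_trans (cong_mulr l sX) _.
  by rewrite -!mulgA jl (mulgA Y) Yl mulgA cong_sym.
rewrite cong_sym; apply: cong_trans sY _.
exact: cong_trans (cong_mulr l kX) Xl.
Qed.

End Inclusion.

End Determined.

(** * Congruences from the action on paths *)

Section Lift.
Variables (S : semigroupType) (c d : congruence S).
Hypothesis cd : forall x y : S, c x y -> d x y.

Definition quot_cong_rel : rel (quot_semigroup c) :=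
  fun a b => d (repr a) (repr b).

Lemma quot_cong_relE (x y : S) :
  quot_cong_rel (quot_pi c x) (quot_pi c y) = d x y.
Proof.
have dr z : d (repr (quot_pi c z)) z by apply/cd/quot_piP; rewrite quot_reprK.
apply/idP/idP => [xy|xy].
  by apply: cong_trans (dr y); apply: cong_trans xy; rewrite cong_sym.
by apply: cong_trans (dr x) _; apply: cong_trans xy _; rewrite cong_sym.
Qed.

Fact quot_cong_refl : reflexive quot_cong_rel.
Proof. by move=> a; exact: cong_refl. Qed.

Fact quot_cong_sym : symmetric quot_cong_rel.
Proof. by move=> a b; exact: cong_sym. Qed.

Fact quot_cong_trans : transitive quot_cong_rel.
Proof. by move=> b a a'; exact: cong_trans. Qed.

Let quot_piME (x y : S) :
  quot_pi c x * quot_pi c y = quot_pi c (x * y) :> quot_semigroup c.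
Proof. by rewrite quot_piM. Qed.

Fact quot_cong_mull z a b : quot_cong_rel a b -> quot_cong_rel (z * a) (z * b).
Proof.
rewrite -(quot_reprK z) -(quot_reprK a) -(quot_reprK b) !quot_piME.
by rewrite !quot_cong_relE; exact: cong_mull.
Qed.

Fact quot_cong_mulr z a b : quot_cong_rel a b -> quot_cong_rel (a * z) (b * z).
Proof.
rewrite -(quot_reprK z) -(quot_reprK a) -(quot_reprK b) !quot_piME.
by rewrite !quot_cong_relE; exact: cong_mulr.
Qed.

Definition quot_cong : congruence (quot_semigroup c) :=
  Congruence quot_cong_refl quot_cong_sym quot_cong_trans quot_cong_mull
    quot_cong_mulr.

End Lift.

Section Action.
Variable E : finite_digraph.
Implicit Types (u v w : vertex E) (e f g : edge E) (p q t : seq (edge E)).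
Implicit Types (K : {set vertex E}).

Local Notation S := (graph_inverse_semigroup E).
Local Notation F := (free_semigroup0 (gis_gen E)).
Local Notation pathtype := (vertex E * seq (edge E))%type.
Implicit Types (a b c : F) (s : pathtype).

(** The action of the generators by partial injections on paths; a path carries its
    source explicitly because its list of edges may be empty. On pairs that are not
    paths the defining relations may fail. *)
Definition act_gen (x : gis_gen E) s : option pathtype :=
  match x with
  | GVertex v => if s.1 == v then Some s else None
  | GEdge e => if s.1 == range e then Some (source e, e :: s.2) else None
  | GInv e => if s.2 is f :: q then
                if f == e then Some (range e, q) else None
              else None
  end.

Definition act a s : option pathtype :=
  if a is Some (x, r) then foldr (fun y => obind (act_gen y)) (Some s) (x :: r)
  else None.

Lemma actM a b s : act (a * b) s = obind (act a) (act b s).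
Proof.
case: a => [[x r]|]; last by case: (act b s).
case: b => [[y t]|] //=; rewrite foldr_cat /=.
move: (obind (act_gen y) _) => [s'|] //=.
by elim: r x => //= z r IH x; rewrite IH.
Qed.

Section Kernel.
Variable K : {set vertex E}.

(** Whether a path ends outside [K] is unaffected by changing its first edges, so
    these paths form an invariant set. *)
Definition path_outside s : Prop := exists2 w, is_path s.1 s.2 w & w \notin K.

Lemma act_gen_path_outside x s s' :
  path_outside s -> act_gen x s = Some s' -> path_outside s'.
Proof.
case: s => u p; case: x => [v|e|e] [w /= up wK].
- by case: eqP => // _ [<-]; exists w.
- case: eqP => // ue [<-]; exists w => //=.
  by rewrite eqxx -ue.
case: p up => //= f q /andP[_ fq]; case: eqP => // <- [<-].
by exists w.
Qed.

Lemma act_path_outside a s s' :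
  path_outside s -> act a s = Some s' -> path_outside s'.
Proof.
case: a => [[x r]|] //= sK; elim: r x s' => [|y r IH] x s' /=.
  exact: act_gen_path_outside.
case rs: (obind (act_gen y) _) => [s1|] //=.
exact: act_gen_path_outside (IH _ _ rs).
Qed.

Definition act_rel : rel F :=
  fun a b => `[< forall s, path_outside s -> act a s = act b s >].

Lemma act_relP a b :
  reflect (forall s, path_outside s -> act a s = act b s) (act_rel a b).
Proof. exact: asboolP. Qed.

Fact act_rel_refl : reflexive act_rel.
Proof. by move=> a; apply/act_relP. Qed.

Fact act_rel_sym : symmetric act_rel.
Proof.
by move=> a b; apply/act_relP/act_relP => ab s sK; rewrite ab.
Qed.

Fact act_rel_trans : transitive act_rel.
Proof.
move=> b a c /act_relP ab /act_relP bc; apply/act_relP => s sK.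
by rewrite ab // bc.
Qed.

Fact act_rel_mull c a b : act_rel a b -> act_rel (c * a) (c * b).
Proof.
by move=> /act_relP ab; apply/act_relP => s sK; rewrite !actM ab.
Qed.

Fact act_rel_mulr c a b : act_rel a b -> act_rel (a * c) (b * c).
Proof.
move=> /act_relP ab; apply/act_relP => s sK; rewrite !actM.
by case cs: (act c s) => [s'|] //=; apply: ab; exact: act_path_outside cs.
Qed.

Definition act_cong : congruence F :=
  Congruence act_rel_refl act_rel_sym act_rel_trans act_rel_mull act_rel_mulr.

Lemma act_cong_gis a b : cong_gen (@gis_relation E) a b -> act_cong a b.
Proof.
apply: cong_gen_min => {}a {}b ab; apply/act_relP => -[u p] [w /= up wK].
case: ab => [v v'|e|e|e|e|e f] /=.
- case: (v =P v') => [<-|vv'] /=; case: eqP => //= ->; first by rewrite eqxx.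
  by case: eqP => // v'v; case: vv'.
- by case: eqP => //= _; rewrite eqxx.
- by case: eqP => //= ->; rewrite eqxx.
- by case: p up => //= g q _; case: eqP => //= _; rewrite eqxx.
- case: p up => [|g q] /=; first by move=> _; case: eqP.
  move=> /andP[/eqP<- _]; case: (g =P e) => [->|ge].
    by rewrite !eqxx /= eqxx.
  by case: eqP => //= _; case: eqP.
by case: (u =P range f) => [->|uf] /=; case: (e =P f) => [->|ef] /=;
  rewrite ?eqxx //; case: eqP => // fe; case: ef.
Qed.

Definition cong_of : congruence S := quot_cong act_cong_gis.

Lemma cong_ofE a b : reflect (forall s, path_outside s -> act a s = act b s)
  (cong_of (gis_class a) (gis_class b)).
Proof.
have -> : cong_of (gis_class a) (gis_class b) = act_rel a b.
  exact: quot_cong_relE act_cong_gis a b.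
exact: act_relP.
Qed.

End Kernel.
End Action.

(** * The lattice of admissible vertex sets *)

Section Admissible.
Import Order.LTheory.
Variable E : finite_digraph.
Hypothesis acyclicE : acyclic E.
Implicit Types (u v w : vertex E) (e f g : edge E) (p q t : seq (edge E)).
Implicit Types (K : {set vertex E}).

Local Notation S := (graph_inverse_semigroup E).
Implicit Types (x y z : S) (rho sigma : congruence S).
Local Notation "0" := (@gis_zero E).

(** In the classification of congruences by a hereditary set [H] and a set [W] of
    vertices with exactly one out-edge leaving [H], this is the union of [H] and
    [W]. *)
Definition collapsed rho : {set vertex E} :=
  [set v | `[< rho (gis_vertex v) 0 \/ exists2 e, source e = v &
                 rho (gis_vertex v) (gis_edge e * gis_inv e) >]].

Lemma collapsedP rho v :
  reflect (rho (gis_vertex v) 0 \/ exists2 e, source e = v &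
                 rho (gis_vertex v) (gis_edge e * gis_inv e))
          (v \in collapsed rho).
Proof. by rewrite inE; exact: asboolP. Qed.

Definition admissible K :=
  forall e f, source e = source f -> source e \in K -> e <> f ->
    descendants (range e) \subset K \/ descendants (range f) \subset K.

Lemma reaches_zero rho v w :
  reaches v w -> rho (gis_vertex v) 0 -> rho (gis_vertex w) 0.
Proof.
move=> [p vp] /(cong_mulr (path_elt v p)) /(cong_mull (path_inv v p)).
by rewrite mul0g mulg0 (vertex_path vp) (path_invK vp).
Qed.

Lemma edge_zero rho e :
    rho (gis_vertex (source e)) (gis_edge e * gis_inv e) ->
  rho (gis_vertex (range e)) 0 -> rho (gis_vertex (source e)) 0.
Proof.
move=> se /(cong_mulr (gis_inv e)) /(cong_mull (gis_edge e)).
rewrite mul0g mulg0 gis_range_inv; exact: cong_trans.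
Qed.

(** If [v ~ e e^-1], then [range f = f^-1 v f ~ f^-1 e e^-1 f = 0]. *)
Lemma edge_zero_neq rho e f : source e = source f -> e <> f ->
    rho (gis_vertex (source e)) (gis_edge e * gis_inv e) ->
  rho (gis_vertex (range f)) 0.
Proof.
move=> ef nef /(cong_mulr (gis_edge f)) /(cong_mull (gis_inv f)).
rewrite {1}ef gis_source_edge -!mulgA !gis_inv_edge eqxx; case: eqP => // _.
by rewrite !mulg0.
Qed.

(** If all descendants of [v] are collapsed, then by induction the ranges of its
    out-edges are identified with zero, so [v ~ e e^-1] forces [v ~ 0]. *)
Lemma collapsed_zero rho v :
  rho (gis_vertex v) 0 <-> descendants v \subset collapsed rho.
Proof.
split=> [v0|].
  apply/subsetP => w /descendantsP vw; apply/collapsedP; left.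
  exact: reaches_zero v0.
move: v; apply: edge_ind => // v IH vK.
have /collapsedP[//|[e ev ve]] : v \in collapsed rho.
  by apply: (subsetP vK); exact: descendants_refl.
subst v; apply: (edge_zero ve); apply: IH => //; apply: subset_trans vK.
exact/descendants_sub/edge_reaches.
Qed.

Lemma admissible_collapsed rho : admissible (collapsed rho).
Proof.
move=> e f ef /collapsedP[e0|[g ge gg]] nef.
  left; apply/collapsed_zero; exact: reaches_zero (edge_reaches e) e0.
rewrite -ge in gg; case: (g =P e) => [geq|nge].
  by right; apply/collapsed_zero; apply: edge_zero_neq gg; rewrite ?geq.
by left; apply/collapsed_zero; apply: edge_zero_neq gg.
Qed.

Lemma collapsed_le rho sigma :
  (rho <= sigma)%O = (collapsed rho \subset collapsed sigma).
Proof.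
apply/cong_leP/subsetP => [rs v /collapsedP[/rs v0|[e ev /rs ve]]|rs].
- by apply/collapsedP; left.
- by apply/collapsedP; right; exists e.
have sub_zero v : rho (gis_vertex v) 0 -> sigma (gis_vertex v) 0.
  by move=> /collapsed_zero vr; apply/collapsed_zero/(subset_trans vr)/subsetP.
apply: congruence_sub => // e er.
have zero_idem : sigma (gis_vertex (source e)) 0 ->
    sigma (gis_vertex (source e)) (gis_edge e * gis_inv e).
  move=> e0; apply: cong_trans (e0) _; rewrite cong_sym -gis_edge_range -mulgA.
  have /(cong_mulr (gis_inv e))/(cong_mull (gis_edge e)) :=
    reaches_zero (edge_reaches e) e0.
  by rewrite mul0g mulg0.
have /rs/collapsedP[//|[g ge gs]] : source e \in collapsed rho.
  by apply/collapsedP; right; exists e.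
case: (e =P g) => [->|neg]; first by rewrite ge.
rewrite -ge in gs.
apply: zero_idem; rewrite -ge; apply: (edge_zero gs); apply: sub_zero.
exact: edge_zero_neq er.
Qed.

Lemma collapsed_inj : injective collapsed.
Proof.
by move=> rho sigma rs; apply: le_anti;
  rewrite !collapsed_le rs subxx.
Qed.

Lemma collapsed_lt rho sigma :
  (rho < sigma)%O = (collapsed rho \proper collapsed sigma).
Proof. by rewrite lt_leAnge !collapsed_le. Qed.

(** For [v] outside [K], the path of length 0 at [v] is fixed by [v] but killed by
    zero and by every [e e^-1]. For [v] in [K], the paths from [v] that end outside
    [K] are nontrivial and, by admissibility, all start with the same edge
    [e] (if there are any), so [v] acts on them as [e e^-1]. *)
Lemma collapsed_cong_of K : admissible K -> collapsed (cong_of K) = K.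
Proof.
move=> aK; apply/setP => v; apply/idP/idP.
  apply: contraLR => vK; have vo : path_outside K (v, [::]) by exists v => /=.
  apply/collapsedP; case=> [/cong_ofE/(_ _ vo)|[e _]]; first by rewrite /= eqxx.
  by rewrite -gis_classM => /cong_ofE/(_ _ vo); rewrite /= eqxx.
move=> vK; apply/collapsedP.
have [vdK|/subsetPn[w /descendantsP vw wK]] :=
    boolP (descendants v \subset K).
  left; apply/cong_ofE => -[u p] [w /= up wK]; case: eqP => // uv.
  case/negP: wK; apply: (subsetP vdK); apply/descendantsP; exists p.
  by rewrite -uv.
have [vw_eq|[e ev ew]] := reachesE vw; first by rewrite -vw_eq vK in wK.
right; exists e => //; rewrite -gis_classM; apply/cong_ofE.
move=> [u p] [x /= up xK]; case: p up => [/eqP ux|f p /= /andP[/eqP fu fx]].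
  by case: eqP => // uv; rewrite -ux uv vK in xK.
case: (f =P e) => [fe|nfe] /=; first by rewrite fe eqxx -fu fe -ev eqxx.
case: eqP => // uv; have ef : source e = source f by rewrite ev fu.
have evK : source e \in K by rewrite ev.
case: (aK e f ef evK) => [fe|edK|fdK]; first by case: nfe.
  by case/negP: wK; apply: (subsetP edK); apply/descendantsP.
by case/negP: xK; apply: (subsetP fdK); apply/descendantsP; exists p.
Qed.

Lemma collapsed_join rho sigma :
  collapsed (rho `|` sigma)%O = collapsed rho :|: collapsed sigma.
Proof.
have aU : admissible (collapsed rho :|: collapsed sigma).
  move=> e f ef /setUP[] eK nef.
    case: (admissible_collapsed ef eK nef) => sub; [left|right];
      exact/(subset_trans sub)/subsetUl.
  case: (admissible_collapsed ef eK nef) => sub; [left|right];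
    exact/(subset_trans sub)/subsetUr.
apply/eqP; rewrite eqEsubset; apply/andP; split; last first.
  by rewrite subUset -!collapsed_le leUl leUr.
rewrite -(collapsed_cong_of aU) -collapsed_le.
by rewrite leUx !collapsed_le collapsed_cong_of // subsetUl subsetUr.
Qed.

Lemma collapsed_meet_sub rho sigma :
  collapsed (rho `&` sigma)%O \subset collapsed rho :&: collapsed sigma.
Proof.
by rewrite subsetI -!collapsed_le leIl leIr.
Qed.

Lemma collapsed_meet rho sigma :
    admissible (collapsed rho :&: collapsed sigma) ->
  collapsed (rho `&` sigma)%O = collapsed rho :&: collapsed sigma.
Proof.
move=> aI; apply/eqP; rewrite eqEsubset collapsed_meet_sub /=.
rewrite -(collapsed_cong_of aI) -collapsed_le.
by rewrite lexI !collapsed_le collapsed_cong_of // subsetIl subsetIr.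
Qed.

(** * Forks *)

(** [range e] is a maximal element of the set of ranges of the edges sharing the
    source of [e], attained by no other such edge. *)
Definition top_edge e :=
  forall g, source g = source e -> reaches (range g) (range e) -> g = e.

Definition fork e f :=
  [/\ source e = source f, e <> f, top_edge e & top_edge f].

(** If the intersection fails to be admissible at the edges [e] and [f], then, up to
    exchange, [range e] has a descendant outside [K1] and [range f] has one outside
    [K2]. All other out-edges then have descendants in [K1], respectively [K2],
    so their ranges do not reach [range e], respectively [range f]: a fork. *)
Lemma admissible_setI K1 K2 : (forall e f, ~ fork e f) ->
  admissible K1 -> admissible K2 -> admissible (K1 :&: K2).
Proof.
move=> nofork a1 a2 e f ef /setIP[e1 e2] nef; rewrite !subsetI.
have a1e g g' : source g = source e -> source g' = source e -> g <> g' ->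
    ~~ (descendants (range g) \subset K1) -> descendants (range g') \subset K1.
  move=> ge g'e ngg' gK; case: (a1 g g') => //; rewrite ?ge ?g'e //.
  by move=> gK'; rewrite gK' in gK.
have a2e g g' : source g = source e -> source g' = source e -> g <> g' ->
    ~~ (descendants (range g) \subset K2) -> descendants (range g') \subset K2.
  move=> ge g'e ngg' gK; case: (a2 g g') => //; rewrite ?ge ?g'e //.
  by move=> gK'; rewrite gK' in gK.
(* It remains to exclude that [g] leaves [K1] and [g'] leaves [K2], as [g] and [g']
   would form a fork. *)
suff main g g' : source g = source e -> source g' = source e -> g <> g' ->
    ~~ (descendants (range g) \subset K1) ->
    descendants (range g') \subset K2.
  have fe : source f = source e by [].
  have nfe : f <> e by move=> fe'; apply: nef.
  have [eK1|eK1] := boolP (descendants (range e) \subset K1).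
    have [fK1|fK1] := boolP (descendants (range f) \subset K1); last first.
      by left; rewrite (main f e).
    have [eK2|eK2] := boolP (descendants (range e) \subset K2); first by left.
    by right; rewrite (a2e e f).
  by right; rewrite (a1e e f) // (main e f).
move=> ge g'e ngg' gK1; apply: contraPT (nofork g g') => g'K2 nf; apply: nf.
split; first by rewrite ge g'e.
- by [].
- move=> h; rewrite ge => he hg; apply: contrapT => nhg.
  have /negP := gK1; apply; apply: subset_trans (descendants_sub hg) _.
  by apply: (a1e g h) => // /esym.
move=> h; rewrite g'e => he hg'; apply: contrapT => nhg'.
have /negP := g'K2; apply; apply: subset_trans (descendants_sub hg') _.
by apply: (a2e g' h) => // /esym.
Qed.

Lemma no_fork_distributive :
  (forall e f, ~ fork e f) -> distributive (congruence S).
Proof.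
move=> nofork; have meetE rho sigma :
    collapsed (rho `&` sigma)%O = collapsed rho :&: collapsed sigma.
  by apply/collapsed_meet/admissible_setI => //; exact: admissible_collapsed.
move=> a b c; split; apply: collapsed_inj; rewrite !(meetE, collapsed_join).
  exact: setIUr.
exact: setUIr.
Qed.

Lemma covered_setD1 rho sigma v :
    v \in collapsed sigma -> collapsed rho = collapsed sigma :\ v ->
  covered_by rho sigma.
Proof.
move=> vs rE; have cardE : #|collapsed sigma| = #|collapsed rho|.+1.
  by rewrite (cardsD1 v) vs -rE.
split=> [|[c]]; first by rewrite collapsed_lt rE properD1.
rewrite !collapsed_lt => /andP[/proper_card rc /proper_card].
by rewrite cardE ltnS leqNgt rc.
Qed.

(** A path from [source e] through [g] to [range e] starts with [e], by maximality;
    if [g] comes later, then [range e] lies on a closed path. *)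
Lemma top_edge_only e g : top_edge e ->
  reaches (source e) (source g) -> reaches (range g) (range e) -> g = e.
Proof.
move=> te sg ge; have [|[k ks kg]] := reachesE sg.
  by move=> /esym/te; exact.
have ke : k = e.
  apply: te ks _; apply: reaches_trans kg _.
  exact: reaches_trans (edge_reaches g) ge.
case: (range_not_reaches_source acyclicE (e := g)).
by apply: reaches_trans ge _; rewrite -ke.
Qed.

Lemma admissible_remove_top e : top_edge e ->
  admissible (descendants (source e) :\ range e).
Proof.
move=> te g h gh /setD1P[_ /descendantsP sg] ngh.
have sub k : source k = source g -> k <> e ->
    descendants (range k) \subset descendants (source e) :\ range e.
  move=> kg nke; rewrite subsetD1 descendants_sub /=.
    by apply/descendantsP => ke; apply: nke; apply: top_edge_only ke;
      rewrite ?kg.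
  by apply: reaches_trans sg _; rewrite -kg; exact: edge_reaches.
case: (g =P e) => [ge|nge]; last by left; exact: sub.
by right; apply: sub => // he; apply: ngh; rewrite ge he.
Qed.

(** With [U] the descendants of the source, the sets [U :\ range e] and
    [U :\ range f] are covered by their join [U]. Their meet lacks the source, whose
    two out-edges [e] and [f] would otherwise contradict admissibility; hence
    [U :\ range e :\ source e] lies strictly between the meet and
    [U :\ range e]. *)
Lemma lower_semimodular_no_fork :
  lower_semimodular (congruence S) -> forall e f, ~ fork e f.
Proof.
move=> lsm e f [ef nef te tf]; pose U := descendants (source e).
have aA := admissible_remove_top te; have aB := admissible_remove_top tf.
rewrite -ef -/U in aA aB.
set a := cong_of (U :\ range e); set b := cong_of (U :\ range f).
have aE : collapsed a = U :\ range e := collapsed_cong_of aA.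
have bE : collapsed b = U :\ range f := collapsed_cong_of aB.
have eU : range e \in U by apply/descendantsP/edge_reaches.
have fU : range f \in U by apply/descendantsP; rewrite ef; exact: edge_reaches.
have refr : range e != range f.
  apply/eqP => ref; apply: nef; apply: tf => //.
  by rewrite ref; exact: reaches_refl.
have joinE : collapsed (a `|` b)%O = U.
  rewrite collapsed_join aE bE; apply/setP => x.
  rewrite !(in_setU, in_setI, in_setD1).
  have [->|xe] /= := eqVneq x (range e); first by rewrite refr eU.
  by case: (x \in U); rewrite ?andbF.
have sU : source e \in U by exact: descendants_refl.
have ser : source e != range e.
  apply/eqP => see; apply: (@range_not_reaches_source _ acyclicE e).
  by rewrite -see; exact: reaches_refl.
have sfr : source e != range f.
  apply/eqP => sef; apply: (@range_not_reaches_source _ acyclicE f).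
  by rewrite -sef ef; exact: reaches_refl.
have covA : covered_by a (a `|` b)%O.
  by apply: (@covered_setD1 _ _ (range e)); rewrite joinE.
have covB : covered_by b (a `|` b)%O.
  by apply: (@covered_setD1 _ _ (range f)); rewrite joinE.
have [[_ noc] _] := lsm a b covA covB; apply: noc.
have aC : admissible (U :\ range e :\ source e).
  move=> g h gh /setD1P[gs /setD1P[_ /descendantsP sg]] _; left.
  have sge := reaches_trans sg (edge_reaches g).
  rewrite !subsetD1 descendants_sub //=; apply/andP; split.
    apply/descendantsP => ge; case/eqP: gs; congr source.
    exact: top_edge_only ge.
  apply/descendantsP => gs'; case: (range_not_reaches_source acyclicE (e := g)).
  exact: reaches_trans gs' sg.
exists (cong_of (U :\ range e :\ source e)).
rewrite !collapsed_lt (collapsed_cong_of aC) aE properD1 ?andbT; last first.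
  by rewrite !(in_setU, in_setI, in_setD1) ser.
have sM : source e \notin collapsed (a `&` b)%O.
  apply/negP => sM; have := admissible_collapsed ef sM nef.
  have subM := collapsed_meet_sub a b; rewrite aE bE in subM.
  case=> /subset_trans/(_ subM)/subsetP/(_ _ (descendants_refl _)).
    by rewrite !(in_setU, in_setI, in_setD1) eqxx.
  by rewrite !(in_setU, in_setI, in_setD1) eqxx /= andbF.
rewrite properE; apply/andP; split.
  rewrite subsetD1 sM andbT -aE.
  exact: subset_trans (collapsed_meet_sub a b) (subsetIl _ _).
apply/subsetPn; exists (range f).
  by rewrite !(in_setU, in_setI, in_setD1) eq_sym sfr eq_sym refr -/U fU.
apply/negP => /(subsetP (collapsed_meet_sub a b)).
by rewrite bE !(in_setU, in_setI, in_setD1) eqxx /= andbF.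
Qed.


(** By induction along edges it suffices to find an edge [m] out of [v] whose range
    reaches the ranges of all edges out of [v]. Choose [m] whose range has the most
    descendants; if some range is not reachable from [range m], choose [n] among the
    edges with such ranges, again with the most descendants. Without parallel
    edges these maxima make [m] and [n] a fork. *)
Lemma no_fork_chain :
    (forall e f, ~ @parallel E e f) -> (forall e f, ~ fork e f) ->
  forall v (x y : vertex E),
    reaches v x -> reaches v y -> reaches x y \/ reaches y x.
Proof.
move=> nopar nofork; apply: edge_ind => // v IH x y vx vy.
have [<-|[g gv gx]] := reachesE vx; first by left.
have [<-|[h hv hy]] := reachesE vy; first by right.
suff [m mv mtop] : exists2 m, source m = v &
    forall k, source k = v -> reaches (range m) (range k).
  by apply: (IH m mv); [apply: reaches_trans gx | apply: reaches_trans hy];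
    exact: mtop.
pose N (k : edge E) := #|descendants (range k)|.
have maxE k l : source k = source l -> N l <= N k ->
    reaches (range l) (range k) -> k = l.
  move=> kl Nlk lk; apply: contrapT => nkl; apply: (nopar k l); split=> //.
  by apply: descendants_inj => //; apply/eqP; rewrite eqEcard descendants_sub.
have [m /eqP mv mmax] :=
  @arg_maxnP _ g (fun k => source k == v) N (introT eqP gv).
exists m => // k kv; apply: contrapT => nmk.
pose Q k := (source k == v) && ~~ `[< reaches (range m) (range k) >].
have Qk : Q k by rewrite /Q kv eqxx; apply/asboolPn.
have [n /andP[/eqP nv /asboolPn nmn] nmax] := @arg_maxnP _ k Q N Qk.
apply: (nofork m n); split; rewrite /top_edge ?mv ?nv //.
- by move=> mn; apply: nmn; rewrite mn; exact: reaches_refl.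
- move=> l lv lm; apply/esym; apply: maxE lm; rewrite ?lv //; apply: mmax.
  exact/eqP.
move=> l lv ln; apply/esym; apply: maxE (ln); rewrite ?lv //; apply: nmax.
rewrite /Q lv eqxx; apply/asboolPn => ml; apply: nmn.
exact: reaches_trans ml ln.
Qed.

End Admissible.

Theorem corollary2p4 (E : finite_digraph) (hE : acyclic E) :
  let L := congruence (graph_inverse_semigroup E) in
  [/\ lower_semimodular L <-> modular L,
      modular L <-> distributive L
    & simple_graph E ->
      (distributive L <->
       forall e f : edge E, source e = source f ->
         reaches (range e) (range f) \/ reaches (range f) (range e))].
Proof.
move=> L; have lsm_distr : lower_semimodular L -> distributive L.
  by move=> /(lower_semimodular_no_fork hE)/(no_fork_distributive hE).
split.
- split; last exact: modular_lower_semimodular.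
  by move=> /lsm_distr/distributive_modular.
- split; last exact: distributive_modular.
  by move=> /modular_lower_semimodular/lsm_distr.
case=> _ nopar; split=> [dL e f ef|chain].
  have nofork := lower_semimodular_no_fork hE
    (modular_lower_semimodular (distributive_modular dL)).
  have nopar' e1 f1 : ~ @parallel E e1 f1.
    by move=> par; apply: nopar; exists e1, f1.
  apply: (no_fork_chain hE nopar' nofork (v := source e)).
    exact: edge_reaches.
  by rewrite ef; exact: edge_reaches.
apply: (no_fork_distributive hE) => e f [ef nef te tf].
case: (chain e f ef) => [ef_r|fe_r]; apply: nef; last exact/esym/te.
exact: tf.
Qed.
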